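(* Let $m,n\ge 1$, $\mathbb{A}=(A_1,\dots,A_n)\in\mathbb{P}_m^n$, $\omega=(w_1,\dots,w_n)\in\Delta_n$, and let $p \geq 1$. Then: (i) for $0 < t \leq 1$, if $P_{t}(\omega; \mathbb{A}) \geq I$ then $P_{t}(\omega; \mathbb{A}) \leq P_{t}(\omega; \mathbb{A}^{p})$; and (ii) for $-1 \leq t < 0$, if $P_{t}(\omega; \mathbb{A}) \leq I$ then $P_{t}(\omega; \mathbb{A}) \geq P_{t}(\omega; \mathbb{A}^{p})$.
   Context: $\mathbb{P}_m$ is the set of $m\times m$ complex Hermitian positive definite matrices; $\le$ is the Loewner order ($A\ge B$ iff $A-B$ is positive semidefinite); $I$ is the identity. $\Delta_n$ is the set of positive probability vectors $\omega=(w_1,\dots,w_n)$, i.e. $w_j>0$ and $\sum_j w_j=1$. $\mathbb{A}^p=(A_1^p,\dots,A_n^p)$ for $p\in\mathbb{R}$. For $A,B\in\mathbb{P}_m$ and $t\in[0,1]$, $A \#_{t} B = A^{1/2} (A^{-1/2} B A^{-1/2})^{t} A^{1/2}$. For $t\in(0,1]$, the Lim–Pálfia power mean $P_t(\omega;\mathbb{A})$ is the unique $X\in\mathbb{P}_m$ satisfying $X = \sum_{i=1}^{n} w_{i} (X \#_{t} A_{i})$ (existence and uniqueness are known). For $t\in[-1,0)$, $P_t(\omega;\mathbb{A}) = P_{-t}(\omega;\mathbb{A}^{-1})^{-1}$. *)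

(* Defs.v *)
From mathcomp Require Import all_boot all_order all_algebra.
From mathcomp Require Import complex.
From mathcomp Require Import classical_sets reals exp.

Set Implicit Arguments.
Unset Strict Implicit.
Unset Printing Implicit Defensive.

Import Order.TTheory GRing.Theory Num.Theory.

Local Open Scope ring_scope.
Local Open Scope complex_scope.
Local Open Scope sesquilinear_scope.

Section Definitions.
Variable R : realType.
Local Notation C := R[i].

(* In R[i], 0 <= z and 0 < z both include the condition that z is real. *)
Definition posdefmx (m : nat) (A : 'M[C]_m) : Prop :=
  A \is hermsymmx /\
  forall x : 'cV[C]_m, x != 0 -> 0 < (x ^t* *m A *m x) 0 0.

Definition possemidefmx (m : nat) (A : 'M[C]_m) : Prop :=
  A \is hermsymmx /\ forall x : 'cV[C]_m, 0 <= (x ^t* *m A *m x) 0 0.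

Definition loewner_le (m : nat) (A B : 'M[C]_m) : Prop :=
  possemidefmx (B - A).

(* Functional calculus on the spectral decomposition
   A = P^-1 diag(d) P, with P = spectralmx A unitary and d = spectral_diag A
   (see orthomx_spectralP); meaningful for A positive definite, where the
   entries of d are positive reals. *)
Definition mxpow (m : nat) (A : 'M[C]_m) (r : R) : 'M[C]_m :=
  invmx (spectralmx A)
  *m diag_mx (\row_j ((complex.Re (spectral_diag A 0 j)) `^ r)%:C)
  *m spectralmx A.

Definition gmean (m : nat) (t : R) (A B : 'M[C]_m) : 'M[C]_m :=
  mxpow A 2^-1
  *m mxpow (mxpow A (- 2^-1) *m B *m mxpow A (- 2^-1)) t
  *m mxpow A 2^-1.

Definition prob_vec (n : nat) (w : 'I_n -> R) : Prop :=
  (forall i, 0 < w i) /\ \sum_i w i = 1.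

Definition power_mean_eq (m n : nat) (t : R) (w : 'I_n -> R)
    (A : 'I_n -> 'M[C]_m) (X : 'M[C]_m) : Prop :=
  posdefmx X /\ X = \sum_i (w i)%:C *: gmean t X (A i).

(* The solution of power_mean_eq exists and is unique when 0 < t <= 1, w is a
   probability vector and the A i are positive definite; the default value
   1%:M is then irrelevant. *)
Definition power_mean_pos (m n : nat) (t : R) (w : 'I_n -> R)
    (A : 'I_n -> 'M[C]_m) : 'M[C]_m :=
  xget 1%:M [set X | power_mean_eq t w A X]%classic.

(* Only meaningful for t in [-1, 1] with t != 0. *)
Definition power_mean (m n : nat) (t : R) (w : 'I_n -> R)
    (A : 'I_n -> 'M[C]_m) : 'M[C]_m :=
  if 0 < t then power_mean_pos t w A
  else invmx (power_mean_pos (- t) w (fun i => invmx (A i))).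

End Definitions.

Notation "A <=L B" := (loewner_le A B) (at level 70, no associativity).

(* Main.v *)
From HB Require Import structures.
Require Import Defs.
From mathcomp Require Import all_boot all_order all_algebra.
From mathcomp Require Import complex.
From mathcomp Require Import reals.
From mathcomp Require Import ring lra.
From mathcomp Require Import boolp classical_sets topology normedtype sequences exp.

Set Implicit Arguments.
Unset Strict Implicit.
Unset Printing Implicit Defensive.

Import Order.TTheory GRing.Theory Num.Theory.
Import numFieldNormedType.Exports.

Local Open Scope ring_scope.
Local Open Scope complex_scope.

(** Fix [0 < t <= 1] and let [F_A X = \sum_i w_i (X #_t A_i)], so that the power
    mean of [A] is the fixed point of [F_A].

    Since [X #_t A = A #_(1-t) X] ([wgmean_sym]), the Loewner-Heinz inequality
    ([loewner_heinz]) makes [F_A] monotone in [X], and it is homogeneous of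
    degree [1 - t < 1].  These two properties replace the contraction of the
    Thompson metric.  They give a fixed point as the limit of an increasing
    bounded iteration ([monotone_homogeneous_fixpoint]), and they give the
    comparison principle [pmean_map_subfixpoint_le]: [X <= F_A X] and
    [Y = F_A Y] imply [X <= Y].  Indeed, if [c] is the least scalar with
    [X <= c Y] and [c > 1], then [X <= F_A (c Y) = c^(1-t) Y] contradicts the
    choice of [c].

    For part (i) it then suffices to show [X <= F_(A^p) X] when [X = F_A X] and
    [X >= 1].  Put [K = X^(-1/2)], a contraction, and [Z_i = K A_i K]; the fixed
    point equation reads [\sum_i w_i Z_i^t = 1].  If [1 <= p <= 2], Hansen's
    inequality ([powmx_hansen]) says [Z_i^p <= K A_i^p K], whence
    [(K A_i^p K)^t >= Z_i^(t p) >= 1 + p (Z_i^t - 1)] by Loewner-Heinz and by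
    Bernoulli's inequality on the spectrum of [Z_i^t].  Averaging cancels the
    linear term and leaves [\sum_i w_i (K A_i^p K)^t >= 1], which is the claim
    after conjugation by [X^(1/2)] ([pmean_map_pow_ge]).  For [p > 2], square
    the matrices first: the power mean stays above [1] and [p] is halved.

    Part (ii) is part (i) for the inverse matrices, because inversion reverses
    the Loewner order.

    Loewner-Heinz itself is obtained by Pedersen's argument: the exponents for
    which it holds are stable under midpoints ([loewner_heinz_midpoint]) and
    form a closed set containing 0 and 1. *)

(** * Matrix identities *)

Section MatrixAlgebra.
Variable T : pzRingType.

Lemma mulmx_cancel_mid m n p q r s (A : 'M[T]_(m, n)) (D : 'M_(n, p)) (U : 'M_(p, q))
    (V : 'M_(q, p)) (E : 'M_(p, r)) (B : 'M_(r, s)) : U *m V = 1%:M ->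
  A *m D *m U *m (V *m E *m B) = A *m (D *m E) *m B.
Proof. by move=> UV; rewrite !mulmxA -(mulmxA _ U V) UV mulmx1. Qed.

Lemma conjmx_intertwine m n (U U' : 'M[T]_m) (V V' : 'M_n) (M : 'M_(m, n)) D E :
  U *m U' = 1%:M -> U' *m U = 1%:M -> V *m V' = 1%:M -> V' *m V = 1%:M ->
  U' *m D *m U *m M = M *m (V' *m E *m V) <->
  D *m (U *m M *m V') = (U *m M *m V') *m E.
Proof.
move=> UU' U'U VV' V'V; split.
  move=> /(congr1 (fun X => U *m X *m V')).
  by rewrite !mulmxA UU' mul1mx => ->; rewrite -(mulmxA _ V V') VV' mulmx1.
move=> /(congr1 (fun X => U' *m X *m V)).
rewrite !mulmxA -(mulmxA _ V' V) V'V mulmx1 => ->.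
by rewrite U'U mul1mx.
Qed.

End MatrixAlgebra.

(** * Hermitian matrices and quadratic forms *)

(** The basic operations are locked: comparing two matrix expressions must not
    unfold adjoints, products and spectral decompositions. *)
HB.lock Definition adjmx (R : realType) m n (A : 'M[R[i]]_(m, n)) : 'M[R[i]]_(n, m) :=
  map_mx Num.conj A^T.
Local Notation "A ^t*" := (adjmx A) (at level 30).

HB.lock Definition qform (R : realType) m (A : 'M[R[i]]_m) (x : 'cV[R[i]]_m) : R :=
  complex.Re ((x^t* *m A *m x) 0 0).

HB.lock Definition udiag (R : realType) m (U : 'M[R[i]]_m) (d : 'I_m -> R) : 'M[R[i]]_m :=
  U^t* *m diag_mx (\row_j (d j)%:C) *m U.

(** The real power [mxpow], locked as well. *)
HB.lock Definition powmx (R : realType) m (A : 'M[R[i]]_m) (r : R) : 'M[R[i]]_m :=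
  mxpow A r.

Section Spectral.
Variable R : realType.
Local Notation C := R[i].

Lemma adjmxK m n (A : 'M[C]_(m, n)) : A^t*^t* = A.
Proof. by rewrite adjmx.unlock trmxCK. Qed.

Lemma map_conj_trmx m n (A : 'M[C]_(m, n)) : map_mx Num.conj A^T = A^t*.
Proof. by rewrite adjmx.unlock. Qed.

Lemma adjmxE m n (A : 'M[C]_(m, n)) i j : (A^t*) i j = (A j i)^*%R.
Proof. by rewrite adjmx.unlock !mxE. Qed.

Lemma adjmxM m n p (A : 'M[C]_(m, n)) (B : 'M[C]_(n, p)) :
  (A *m B)^t* = B^t* *m A^t*.
Proof. by rewrite adjmx.unlock trmx_mul map_mxM. Qed.

Lemma adjmxD m n (A B : 'M[C]_(m, n)) : (A + B)^t* = A^t* + B^t*.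
Proof. by rewrite adjmx.unlock linearD map_mxD. Qed.

Lemma adjmxB m n (A B : 'M[C]_(m, n)) : (A - B)^t* = A^t* - B^t*.
Proof. by rewrite adjmx.unlock linearB map_mxB. Qed.

Lemma conjC_real (c : R) : (c%:C)^*%R = c%:C.
Proof. by apply/eqP; rewrite -CrealE complex_real. Qed.

Lemma adjmxZ m n (c : R) (A : 'M[C]_(m, n)) : (c%:C *: A)^t* = c%:C *: A^t*.
Proof. by rewrite adjmx.unlock linearZ map_mxZ /= conjC_real. Qed.

Lemma adjmx1 m : (1%:M : 'M[C]_m)^t* = 1%:M.
Proof. by rewrite adjmx.unlock trmx1 map_mx1. Qed.

Lemma hermsymmxP m (A : 'M[C]_m) : reflect (A^t* = A) (A \is hermsymmx).
Proof.
by rewrite adjmx.unlock is_hermitianmxE expr0 scale1r eq_sym; exact: eqP.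
Qed.

(** [`|z| ^ 2] as a real number. *)
Definition normsq (z : C) : R := complex.Re z ^+ 2 + complex.Im z ^+ 2.

Lemma normsqE z : z^*%R * z = (normsq z)%:C.
Proof.
rewrite mulrC -normCK [in LHS]normc_def -rmorphXn /= sqr_sqrtr //.
by rewrite addr_ge0 ?sqr_ge0.
Qed.

Lemma normsq_ge0 z : 0 <= normsq z.
Proof. by rewrite addr_ge0 ?sqr_ge0. Qed.

Lemma normsq_gt0 z : z != 0 -> 0 < normsq z.
Proof.
case: z => a b; rewrite eq_complex /= negb_and /normsq /= => /orP[] h.
  by rewrite ltr_pwDl ?sqr_ge0 // exprn_even_gt0.
by rewrite ltr_pwDr ?sqr_ge0 // exprn_even_gt0.
Qed.

Lemma complex_ReD (a b : C) : complex.Re (a + b) = complex.Re a + complex.Re b.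
Proof. by case: a b => [a1 a2] [b1 b2]. Qed.

Lemma complex_ReZ (c : R) (a : C) : complex.Re (c%:C * a) = c * complex.Re a.
Proof. by case: a => a1 a2 /=; rewrite mul0r subr0. Qed.

Lemma complex_Re_conj (a : C) : complex.Re (a^*%R) = complex.Re a.
Proof. by case: a. Qed.

Lemma complex_Re_sum I (r : seq I) (F : I -> C) :
  complex.Re (\sum_(i <- r) F i) = \sum_(i <- r) complex.Re (F i).
Proof. by elim/big_rec2: _ => // i y1 y2 _ <-; rewrite complex_ReD. Qed.

Lemma qformD m (A B : 'M[C]_m) x : qform (A + B) x = qform A x + qform B x.
Proof. by rewrite qform.unlock mulmxDr mulmxDl mxE complex_ReD. Qed.

Lemma qformZ m (c : R) (A : 'M[C]_m) x : qform (c%:C *: A) x = c * qform A x.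
Proof. by rewrite qform.unlock -scalemxAr -scalemxAl mxE complex_ReZ. Qed.

Lemma qformN m (A : 'M[C]_m) x : qform (- A) x = - qform A x.
Proof. by rewrite qform.unlock mulmxN mulNmx mxE; case: ((_ *m _) 0 0). Qed.

Lemma qformB m (A B : 'M[C]_m) x : qform (A - B) x = qform A x - qform B x.
Proof. by rewrite qformD qformN. Qed.

Lemma qform_adj m (A : 'M[C]_m) x : qform (A^t*) x = qform A x.
Proof.
rewrite qform.unlock -[x in _ *m x]adjmxK -mulmxA -!adjmxM -mulmxA.
by rewrite adjmxE complex_Re_conj.
Qed.

Lemma qform_conj m n (A : 'M[C]_m) (M : 'M[C]_(m, n)) x :
  qform (M^t* *m A *m M) x = qform A (M *m x).
Proof. by rewrite qform.unlock adjmxM !mulmxA. Qed.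

Lemma unitmx_right_inverse m (A B : 'M[C]_m) : A *m B = 1%:M -> A \in unitmx.
Proof. by case/mulmx1_unit. Qed.

Lemma qformx0 m (A : 'M[C]_m) : qform A 0 = 0.
Proof. by rewrite qform.unlock mulmx0 mxE. Qed.

Lemma adjmx_unit m (Y : 'M[C]_m) : (Y^t* \in unitmx) = (Y \in unitmx).
Proof. by rewrite adjmx.unlock map_unitmx unitmx_tr. Qed.

Lemma qform1 m (x : 'cV[C]_m) : qform 1%:M x = \sum_j normsq (x j 0).
Proof.
rewrite qform.unlock mulmx1 mxE complex_Re_sum; apply: eq_bigr => j _.
by rewrite adjmxE normsqE.
Qed.

Lemma qform1_gt0 m (x : 'cV[C]_m) : x != 0 -> 0 < qform 1%:M x.
Proof.
move=> /cV0Pn[j xj]; rewrite qform1 (bigD1 j) //=.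
by rewrite ltr_pwDl ?normsq_gt0 // sumr_ge0 // => i _; rewrite normsq_ge0.
Qed.

(** The form of a Hermitian matrix is real, so that the positivity conditions,
    stated in the complex numbers, become inequalities between reals. *)
Lemma herm_entry m (A : 'M[C]_m) x : A \is hermsymmx ->
  (map_mx Num.conj x^T *m A *m x) 0 0 = (qform A x)%:C.
Proof.
move=> /hermsymmxP hA; rewrite map_conj_trmx qform.unlock RRe_real // CrealE; apply/eqP.
have : (x^t* *m A *m x)^t* = x^t* *m A *m x.
  by rewrite !adjmxM hA adjmxK mulmxA.
by move=> /matrixP/(_ 0 0); rewrite adjmxE.
Qed.

Lemma posdef_qform m (A : 'M[C]_m) : posdefmx A <->
  A^t* = A /\ forall x, x != 0 -> 0 < qform A x.
Proof.
split=> -[h hx]; split; try exact/hermsymmxP.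
- by move=> x x0; have := hx x x0; rewrite herm_entry // ltcR.
- move=> x x0; rewrite herm_entry ?ltcR ?hx //; exact/hermsymmxP.
Qed.

Lemma possemidef_qform m (A : 'M[C]_m) : possemidefmx A <->
  A^t* = A /\ forall x, 0 <= qform A x.
Proof.
split=> -[h hx]; split; try exact/hermsymmxP.
- by move=> x; have := hx x; rewrite herm_entry // lecR.
- move=> x; rewrite herm_entry ?lecR ?hx //; exact/hermsymmxP.
Qed.

(** * Spectral decomposition and functional calculus *)

Lemma udiagE m (U : 'M[C]_m) d :
  udiag U d = U^t* *m diag_mx (\row_j (d j)%:C) *m U.
Proof. by rewrite udiag.unlock. Qed.

Lemma udiag_row m (U : 'M[C]_m) (v : 'rV[C]_m) d :
  (forall j, v 0 j = (d j)%:C) -> U^t* *m diag_mx v *m U = udiag U d.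
Proof.
move=> vd; rewrite udiagE; suff -> : v = \row_j (d j)%:C by [].
by apply/rowP => j; rewrite vd mxE.
Qed.

Lemma eq_udiag m (U : 'M[C]_m) d e : d =1 e -> udiag U d = udiag U e.
Proof. by move=> /funext ->. Qed.

Lemma udiag_adj m (U : 'M[C]_m) d : (udiag U d)^t* = udiag U d.
Proof.
rewrite [in LHS]udiagE !adjmxM adjmxK -[X in _ *m (X *m _)]map_conj_trmx.
rewrite tr_diag_mx map_diag_mx mulmxA.
by apply: udiag_row => j; rewrite !mxE; exact: conjC_real.
Qed.

Lemma unitary_mul_adj m (U : 'M[C]_m) : U \is unitarymx -> U *m U^t* = 1%:M.
Proof. by move/unitarymxP; rewrite adjmx.unlock. Qed.

Lemma unitary_adj_mul m (U : 'M[C]_m) : U \is unitarymx -> U^t* *m U = 1%:M.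
Proof. by move/unitary_mul_adj/mulmx1C. Qed.

Lemma qform_udiag m (U : 'M[C]_m) d x :
  qform (udiag U d) x = \sum_j d j * normsq ((U *m x) j 0).
Proof.
rewrite udiag.unlock qform_conj; move: (U *m x) => y.
rewrite qform.unlock mxE complex_Re_sum.
apply: eq_bigr => j _; rewrite mul_mx_diag mxE adjmxE mxE.
by rewrite mulrAC mulrC complex_ReZ normsqE.
Qed.

Lemma udiagD m (U : 'M[C]_m) d e :
  udiag U d + udiag U e = udiag U (fun j => d j + e j).
Proof.
rewrite [in LHS]udiagE (udiagE U e) -mulmxDl -mulmxDr -raddfD.
by apply: udiag_row => j; rewrite !mxE rmorphD.
Qed.

Lemma udiagZ m (U : 'M[C]_m) c d :
  c%:C *: udiag U d = udiag U (fun j => c * d j).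
Proof.
rewrite [in LHS]udiagE scalemxAl scalemxAr -linearZ.
by apply: udiag_row => j; rewrite !mxE rmorphM.
Qed.

Lemma udiagM m (U : 'M[C]_m) d e : U \is unitarymx ->
  udiag U d *m udiag U e = udiag U (fun j => d j * e j).
Proof.
move=> uU; rewrite (udiagE U d) (udiagE U e).
rewrite (mulmx_cancel_mid _ _ _ _ (unitary_mul_adj uU)) mulmx_diag.
by apply: udiag_row => j; rewrite !mxE rmorphM.
Qed.

Lemma udiag_const m (U : 'M[C]_m) c : U \is unitarymx ->
  udiag U (fun=> c) = c%:C *: 1%:M.
Proof.
move=> uU; rewrite -(unitary_adj_mul uU) udiag.unlock scalemxAl -[in RHS](mulmx1 (U^t*)).
rewrite scalemxAr; have -> // : diag_mx (\row_j c%:C) = c%:C *: 1%:M :> 'M[C]_m.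
by apply/matrixP => i j; rewrite !mxE mulr_natr.
Qed.

Lemma udiag1 m (U : 'M[C]_m) : U \is unitarymx -> udiag U (fun=> 1) = 1%:M.
Proof. by move=> uU; rewrite udiag_const // scale1r. Qed.

Lemma udiag_gt0 m (U : 'M[C]_m) d : U \is unitarymx -> (forall j, 0 < d j) ->
  posdefmx (udiag U d).
Proof.
move=> uU d0; apply/posdef_qform; split; first exact: udiag_adj.
move=> x x0; rewrite qform_udiag.
have /cV0Pn[j xj] : U *m x != 0.
  apply: contra_neq x0 => /(congr1 (mulmx (U^t*))).
  by rewrite mulmxA unitary_adj_mul // mul1mx mulmx0.
rewrite (bigD1 j) //= ltr_pwDl ?mulr_gt0 ?normsq_gt0 //.
by rewrite sumr_ge0 // => i _; rewrite mulr_ge0 ?normsq_ge0 ?ltW.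
Qed.

Lemma trace_udiag m (U : 'M[C]_m) d : U \is unitarymx ->
  \sum_j complex.Re (udiag U d j j) = \sum_j d j.
Proof.
move=> uU; rewrite -complex_Re_sum -[X in complex.Re X]/(\tr _) udiag.unlock.
rewrite mxtrace_mulC mulmxA unitary_mul_adj // mul1mx mxtrace_diag complex_Re_sum.
by apply: eq_bigr => j _; rewrite mxE.
Qed.

(** The eigenvector of [udiag U d] for the eigenvalue [d j]. *)
Definition eigcol m (U : 'M[C]_m) j : 'cV[C]_m := U^t* *m delta_mx j 0.

Lemma eigcol_neq0 m (U : 'M[C]_m) j : U \is unitarymx -> eigcol U j != 0.
Proof.
move=> uU; apply/eqP => /(congr1 (mulmx U)).
rewrite mulmxA unitary_mul_adj // mul1mx mulmx0 => /matrixP/(_ j 0).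
by rewrite !mxE !eqxx => /eqP; rewrite oner_eq0.
Qed.

Lemma udiag_eigcol m (U : 'M[C]_m) d j : U \is unitarymx ->
  udiag U d *m eigcol U j = (d j)%:C *: eigcol U j.
Proof.
move=> uU; rewrite udiag.unlock /eigcol mulmxA -(mulmxA _ U) unitary_mul_adj // mulmx1.
rewrite -mulmxA scalemxAr.
suff -> : diag_mx (\row_j0 (d j0)%:C) *m (delta_mx j 0 : 'cV_m)
    = (d j)%:C *: delta_mx j 0 by [].
apply/matrixP => i k; rewrite mul_diag_mx !mxE.
by have [->|] := eqVneq i j; rewrite ?mulr0.
Qed.

Lemma qform_eigen m (A : 'M[C]_m) c x : A *m x = c%:C *: x ->
  qform A x = c * qform 1%:M x.
Proof.
by move=> h; rewrite qform.unlock -!mulmxA h mul1mx -scalemxAr mxE complex_ReZ.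
Qed.

Lemma qform_eigcol m (U : 'M[C]_m) d j : U \is unitarymx ->
  qform (udiag U d) (eigcol U j) = d j * qform 1%:M (eigcol U j).
Proof. by move=> uU; apply/qform_eigen/udiag_eigcol. Qed.

Lemma herm_spectral m (A : 'M[C]_m) : A^t* = A ->
  A = udiag (spectralmx A) (fun j => complex.Re (spectral_diag A 0 j)).
Proof.
move=> /hermsymmxP hA.
have /hermitian_normalmx /orthomx_spectralP AE := hA.
rewrite {1}AE (invmx_unitary (spectral_unitarymx A)) map_conj_trmx.
apply: udiag_row => j; rewrite RRe_real //.
by have /mxOverP := hermitian_spectral_diag_real hA.
Qed.

Lemma powmxE m (A : 'M[C]_m) r : powmx A r =
  udiag (spectralmx A) (fun j => (complex.Re (spectral_diag A 0 j)) `^ r).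
Proof.
rewrite powmx.unlock /mxpow (invmx_unitary (spectral_unitarymx A)) map_conj_trmx.
by rewrite udiagE.
Qed.

(** In the eigenbases the hypothesis says [d i * N i j = N i j * e j] for
    [N = U M V^t*]; wherever [N i j] does not vanish, [d i = e j] and hence
    [f (d i) = f (e j)].  With [M = 1] this shows that functional calculus does
    not depend on the diagonalization; with [M = Y] it is the source of the
    identity [powmx_mul_adj]. *)
Lemma udiag_intertwine m n (U : 'M[C]_m) (V : 'M[C]_n) d e (M : 'M[C]_(m, n)) f :
  U \is unitarymx -> V \is unitarymx ->
  udiag U d *m M = M *m udiag V e ->
  udiag U (f \o d) *m M = M *m udiag V (f \o e).
Proof.
move=> uU uV h.
have core g k : udiag U g *m M = M *m udiag V k <->
    forall i j, (g i)%:C * (U *m M *m V^t*) i j = (U *m M *m V^t*) i j * (k j)%:C.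
  rewrite !udiagE; apply: (iff_trans (conjmx_intertwine _ _ _ (unitary_mul_adj uU)
    (unitary_adj_mul uU) (unitary_mul_adj uV) (unitary_adj_mul uV))).
  move: (U *m M *m _) => N; split.
    by move=> /matrixP E i j; have := E i j; rewrite mul_diag_mx mul_mx_diag !mxE.
  by move=> E; apply/matrixP => i j; rewrite mul_diag_mx mul_mx_diag !mxE.
apply/core => i j; have /core/(_ i j) := h.
have [->|nz] := eqVneq ((U *m M *m V^t*) i j) 0; first by rewrite !(mulr0, mul0r).
rewrite [RHS]mulrC => /(mulIf nz) /= [->].
by rewrite mulrC.
Qed.

Lemma powmx_udiag m (U : 'M[C]_m) d r : U \is unitarymx ->
  powmx (udiag U d) r = udiag U (fun j => d j `^ r).
Proof.
move=> uU; set A := udiag U d; rewrite powmxE.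
rewrite -[LHS]mulmx1 -[RHS]mul1mx.
apply: (udiag_intertwine (fun a => a `^ r) (spectral_unitarymx A) uU).
rewrite mulmx1 mul1mx -herm_spectral //; exact: udiag_adj.
Qed.

End Spectral.

(** * The Loewner order and real powers *)

(* From here on the order is used only through its quadratic forms. *)
#[local] Opaque loewner_le possemidefmx posdefmx.

Section LoewnerOrder.
Variable R : realType.
Local Notation C := R[i].

Lemma loewner_qform m (A B : 'M[C]_m) : A <=L B <->
  (B - A)^t* = B - A /\ forall x, qform A x <= qform B x.
Proof.
apply: (iff_trans (possemidef_qform _)); split=> -[h hx]; split=> // x;
  by have := hx x; rewrite qformB subr_ge0.
Qed.

Lemma loewner_qform_herm m (A B : 'M[C]_m) : A^t* = A -> B^t* = B ->
  A <=L B <-> forall x, qform A x <= qform B x.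
Proof.
move=> hA hB; split; first by case/loewner_qform.
by move=> h; apply/loewner_qform; rewrite adjmxB hA hB.
Qed.

Lemma loewner_refl m (A : 'M[C]_m) : A <=L A.
Proof.
apply/loewner_qform; split=> //.
by rewrite adjmxB !subrr.
Qed.

Lemma loewner_trans m (A B D : 'M[C]_m) : A <=L B -> B <=L D -> A <=L D.
Proof.
move=> /loewner_qform[h1 q1] /loewner_qform[h2 q2]; apply/loewner_qform; split.
  have -> : D - A = (D - B) + (B - A) by rewrite addrA subrK.
  by rewrite adjmxD h1 h2.
by move=> x; apply: le_trans (q1 x) (q2 x).
Qed.

Lemma loewner_add m (A B D E : 'M[C]_m) : A <=L B -> D <=L E -> A + D <=L B + E.
Proof.
move=> /loewner_qform[h1 q1] /loewner_qform[h2 q2]; apply/loewner_qform; split.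
  by rewrite opprD addrACA adjmxD h1 h2.
by move=> x; rewrite !qformD lerD.
Qed.

Lemma loewner_scale m (c : R) (A B : 'M[C]_m) : 0 <= c -> A <=L B ->
  c%:C *: A <=L c%:C *: B.
Proof.
move=> c0 /loewner_qform[h q]; apply/loewner_qform; split.
  by rewrite -scalerBr adjmxZ h.
by move=> x; rewrite !qformZ ler_wpM2l.
Qed.

Lemma loewner_sum m n (F G : 'I_n -> 'M[C]_m) : (forall i, F i <=L G i) ->
  \sum_i F i <=L \sum_i G i.
Proof.
move=> FG; elim/big_rec2: _ => [|i A B _ AB]; first exact: loewner_refl.
exact: loewner_add (FG i) AB.
Qed.

Lemma loewner_conj m n (M : 'M[C]_(m, n)) (A B : 'M[C]_m) : A <=L B ->
  M^t* *m A *m M <=L M^t* *m B *m M.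
Proof.
move=> /loewner_qform[h q]; apply/loewner_qform; split.
  rewrite -mulmxBl -mulmxBr; move: (B - A) h => D h.
  by rewrite !adjmxM h adjmxK mulmxA.
by move=> x; rewrite !qform_conj.
Qed.

Lemma posdef_adj m (A : 'M[C]_m) : posdefmx A -> A^t* = A.
Proof. by case/posdef_qform. Qed.

Lemma posdef_loewner m (A B : 'M[C]_m) : posdefmx A -> A <=L B -> posdefmx B.
Proof.
move=> /posdef_qform[hA qA] /loewner_qform[h q]; apply/posdef_qform; split.
  by rewrite -[B](subrK A) adjmxD h hA.
by move=> x x0; apply: lt_le_trans (qA x x0) (q x).
Qed.

Lemma udiag_le m (U : 'M[C]_m) d e : (forall j, d j <= e j) ->
  udiag U d <=L udiag U e.
Proof.
move=> de; apply: (proj2 (loewner_qform_herm (udiag_adj _ _) (udiag_adj _ _))) => x.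
by rewrite !qform_udiag ler_sum // => j _; rewrite ler_wpM2r ?normsq_ge0.
Qed.

Lemma udiag_le_inv m (U : 'M[C]_m) d e : U \is unitarymx ->
  udiag U d <=L udiag U e -> forall j, d j <= e j.
Proof.
move=> uU /loewner_qform[_ q] j; have := q (eigcol U j).
by rewrite !qform_eigcol // ler_pM2r // qform1_gt0 // eigcol_neq0.
Qed.

Lemma possemidef_spectral m (A : 'M[C]_m) : possemidefmx A ->
  exists U (d : 'I_m -> R), [/\ U \is unitarymx, forall j, 0 <= d j & A = udiag U d].
Proof.
move=> /possemidef_qform[/herm_spectral AE qA].
set U := spectralmx A in AE; set d := fun j => _ in AE.
have uU : U \is unitarymx by exact: spectral_unitarymx.
exists U, d; split=> // j; have := qA (eigcol U j).
by rewrite AE qform_eigcol // pmulr_lge0 // qform1_gt0 // eigcol_neq0.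
Qed.

Lemma posdef_spectral m (A : 'M[C]_m) : posdefmx A ->
  exists U (d : 'I_m -> R), [/\ U \is unitarymx, forall j, 0 < d j & A = udiag U d].
Proof.
move=> /posdef_qform[/herm_spectral AE qA].
set U := spectralmx A in AE; set d := fun j => _ in AE.
have uU : U \is unitarymx by exact: spectral_unitarymx.
exists U, d; split=> // j; have := qA (eigcol U j) (eigcol_neq0 j uU).
by rewrite AE qform_eigcol // pmulr_lgt0 // qform1_gt0 // eigcol_neq0.
Qed.

(** The spectrum of [B - A] is both nonnegative and nonpositive. *)
Lemma loewner_antisym m (A B : 'M[C]_m) : A <=L B -> B <=L A -> A = B.
Proof.
move=> AB BA; apply/eqP; rewrite eq_sym -subr_eq0; apply/eqP.
have [U [d [uU d0 DE]]] := possemidef_spectral AB.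
have d00 j : d j = 0.
  apply/eqP; rewrite eq_le d0 andbT.
  have /loewner_qform[_ /(_ (eigcol U j))] := BA.
  rewrite -subr_le0 -qformB DE qform_eigcol // pmulr_lle0 //.
  by rewrite qform1_gt0 // eigcol_neq0.
by rewrite DE (eq_udiag _ d00) udiag_const // scale0r.
Qed.

(** Each eigenvalue is at most the sum of all of them. *)
Lemma loewner_trace m (A : 'M[C]_m) : possemidefmx A ->
  A <=L (\sum_j complex.Re (A j j))%:C *: 1%:M.
Proof.
move=> /possemidef_spectral[U [d [uU d0 ->]]].
rewrite trace_udiag //.
rewrite -(udiag_const _ uU); apply: udiag_le => j.
by rewrite (bigD1 j) //= lerDl sumr_ge0.
Qed.

Lemma posdef_scale m (c : R) (A : 'M[C]_m) : 0 < c -> posdefmx A ->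
  posdefmx (c%:C *: A).
Proof.
move=> c0 /posdef_qform[hA qA]; apply/posdef_qform.
by rewrite adjmxZ hA; split=> // x x0; rewrite qformZ mulr_gt0 ?qA.
Qed.

Lemma posdef1 m : posdefmx (1%:M : 'M[C]_m).
Proof. by apply/posdef_qform; rewrite adjmx1; split=> // x; exact: qform1_gt0. Qed.

Lemma posdef_possemidef m (A : 'M[C]_m) : posdefmx A -> possemidefmx A.
Proof.
move=> /posdef_qform[hA qA]; apply/possemidef_qform; split=> // x.
have [->|/qA/ltW//] := eqVneq x 0.
by rewrite qformx0.
Qed.

Lemma posdef_conj m (A M : 'M[C]_m) : M \in unitmx -> posdefmx A ->
  posdefmx (M^t* *m A *m M).
Proof.
move=> uM /posdef_qform[hA qA]; apply/posdef_qform; split.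
  by rewrite !adjmxM hA adjmxK mulmxA.
move=> x x0; rewrite qform_conj qA //; apply: contra_neq x0 => Mx.
by rewrite -[x](mulKmx uM) Mx mulmx0.
Qed.

Lemma powmx_adj m (A : 'M[C]_m) r : (powmx A r)^t* = powmx A r.
Proof. by rewrite powmxE udiag_adj. Qed.

Lemma powmx_posdef m (A : 'M[C]_m) r : posdefmx A -> posdefmx (powmx A r).
Proof.
move=> /posdef_spectral[U [d [uU d0 ->]]]; rewrite (powmx_udiag _ _ uU).
by apply: udiag_gt0 => // j; rewrite powR_gt0.
Qed.

Lemma powmxD m (A : 'M[C]_m) r s : posdefmx A ->
  powmx A (r + s) = powmx A r *m powmx A s.
Proof.
move=> /posdef_spectral[U [d [uU d0 ->]]]; rewrite !(powmx_udiag _ _ uU) (udiagM _ _ uU).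
by apply: eq_udiag => j; rewrite powRD // lt0r_neq0 ?implybT.
Qed.

Lemma powmx0 m (A : 'M[C]_m) : posdefmx A -> powmx A 0 = 1%:M.
Proof.
move=> /posdef_spectral[U [d [uU d0 ->]]]; rewrite (powmx_udiag _ _ uU) -(udiag1 uU).
by apply: eq_udiag => j; rewrite powRr0.
Qed.

Lemma powmx1 m (A : 'M[C]_m) : posdefmx A -> powmx A 1 = A.
Proof.
move=> /posdef_spectral[U [d [uU d0 ->]]]; rewrite (powmx_udiag _ _ uU).
by apply: eq_udiag => j; rewrite powRr1 // ltW.
Qed.

Lemma powmxrM m (A : 'M[C]_m) r s : posdefmx A ->
  powmx (powmx A r) s = powmx A (r * s).
Proof.
move=> /posdef_spectral[U [d [uU d0 ->]]]; rewrite !(powmx_udiag _ _ uU).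
by apply: eq_udiag => j; rewrite powRrM.
Qed.

Lemma powmx_mulN m (A : 'M[C]_m) r : posdefmx A -> powmx A r *m powmx A (- r) = 1%:M.
Proof. by move=> pA; rewrite -powmxD // subrr powmx0. Qed.

Lemma powmx_mulNr m (A : 'M[C]_m) r : posdefmx A -> powmx A (- r) *m powmx A r = 1%:M.
Proof. by move=> pA; rewrite -powmxD // addNr powmx0. Qed.

Lemma powmx_unit m (A : 'M[C]_m) r : posdefmx A -> powmx A r \in unitmx.
Proof. by move/(powmx_mulN r)/unitmx_right_inverse. Qed.

Lemma posdef_unit m (A : 'M[C]_m) : posdefmx A -> A \in unitmx.
Proof. by move=> pA; rewrite -(powmx1 pA) powmx_unit. Qed.

Lemma invmx_powmx m (A : 'M[C]_m) : posdefmx A -> invmx A = powmx A (-1).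
Proof.
move=> pA; have uA := posdef_unit pA.
by rewrite -[RHS](mulKmx uA) -{3}(powmx1 pA) (powmx_mulN 1 pA) mulmx1.
Qed.

Lemma powmx_scale m c (A : 'M[C]_m) r : 0 < c -> posdefmx A ->
  powmx (c%:C *: A) r = (c `^ r)%:C *: powmx A r.
Proof.
move=> c0 /posdef_spectral[U [d [uU d0 ->]]]; rewrite udiagZ !(powmx_udiag _ _ uU) udiagZ.
by apply: eq_udiag => j; rewrite powRM // ltW.
Qed.

Lemma powmx1l m r : powmx (1%:M : 'M[C]_m) r = 1%:M.
Proof.
have /posdef_spectral[U [d [uU _ _]]] := posdef1 m.
rewrite -(udiag1 uU) (powmx_udiag _ _ uU).
by apply: eq_udiag => j; rewrite powR1.
Qed.

Lemma powmx_intertwine m n (A : 'M[C]_m) (B : 'M[C]_n) (M : 'M[C]_(m, n)) r :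
  posdefmx A -> posdefmx B -> A *m M = M *m B ->
  powmx A r *m M = M *m powmx B r.
Proof.
move=> /posdef_spectral[U [d [uU d0 ->]]] /posdef_spectral[V [e [uV e0 ->]]] h.
rewrite (powmx_udiag _ _ uU) (powmx_udiag _ _ uV).
exact: (udiag_intertwine (fun a => a `^ r) uU uV h).
Qed.

Lemma posdef_adj_mul m (Y : 'M[C]_m) : Y \in unitmx -> posdefmx (Y^t* *m Y).
Proof. by move=> uY; have := posdef_conj uY (posdef1 m); rewrite mulmx1. Qed.

Lemma posdef_mul_adj m (Y : 'M[C]_m) : Y \in unitmx -> posdefmx (Y *m Y^t*).
Proof. by rewrite -adjmx_unit => /posdef_adj_mul; rewrite adjmxK. Qed.

(** The factor [Y] intertwines [Y Y^t*] with [Y^t* Y], since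
    [(Y Y^t* ) Y = Y (Y^t* Y)].  This trades a power of one product for a power
    of the other; it gives both the symmetry of the geometric mean and Hansen's
    inequality. *)
Lemma powmx_mul_adj m (Y : 'M[C]_m) r : Y \in unitmx ->
  powmx (Y *m Y^t*) (r + 1) = Y *m powmx (Y^t* *m Y) r *m Y^t*.
Proof.
move=> uY; have pYY := posdef_mul_adj uY.
rewrite powmxD // powmx1 // mulmxA; congr (_ *m _).
exact: (powmx_intertwine r pYY (posdef_adj_mul uY) (esym (mulmxA Y (Y^t*) Y))).
Qed.

End LoewnerOrder.

(** * The Loewner-Heinz inequality *)

Section LoewnerHeinz.
Variable R : realType.
Local Notation C := R[i].

Lemma qform_gram_ge0 m (Y : 'M[C]_m) x : 0 <= qform (Y^t* *m Y) x.
Proof.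
rewrite -[Y^t*]mulmx1 qform_conj qform1 sumr_ge0 // => j _.
exact: normsq_ge0.
Qed.

(** Expand the square of [T^t* - S]. *)
Lemma qform_mul_le m (T S : 'M[C]_m) x :
  qform (T *m S) x *+ 2 <= qform (T *m T^t*) x + qform (S^t* *m S) x.
Proof.
have := qform_gram_ge0 (T^t* - S) x.
rewrite adjmxB adjmxK mulmxBl !mulmxBr.
rewrite !qformB -(qform_adj (S^t* *m T^t*)) adjmxM !adjmxK.
move: (qform (T *m T^t*) x) (qform (T *m S) x) (qform (S^t* *m S) x) => a b c.
by lra.
Qed.

Lemma powmx_mulA m n (A : 'M[C]_m) r s (X : 'M[C]_(m, n)) : posdefmx A ->
  powmx A r *m (powmx A s *m X) = powmx A (r + s) *m X.
Proof. by move=> pA; rewrite mulmxA (powmxD _ _ pA). Qed.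

Lemma loewner_conj_herm m (M A B : 'M[C]_m) : M^t* = M -> A <=L B ->
  M *m A *m M <=L M *m B *m M.
Proof. by move=> hM /(loewner_conj M); rewrite hM. Qed.

Lemma powmx_sandwich m (A : 'M[C]_m) r s : posdefmx A ->
  powmx A r *m powmx A s *m powmx A r = powmx A (r + s + r).
Proof. by move=> pA; rewrite -!(powmxD _ _ pA). Qed.

(** With [h = (s + t) / 2], the claim is that every eigenvalue of
    [B^(-h/2) A^h B^(-h/2)] is at most 1.  This matrix is similar, through
    [B^((s-t)/4)], to the product of [T = B^(-t/2) A^(t/2)] and
    [S = A^(s/2) B^(-s/2)], which are contractions by hypothesis, and
    eigenvalues of a product of contractions are at most 1. *)
Lemma loewner_heinz_midpoint m (A B : 'M[C]_m) s t : posdefmx A -> posdefmx B ->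
  powmx A s <=L powmx B s -> powmx A t <=L powmx B t ->
  powmx A ((s + t) / 2) <=L powmx B ((s + t) / 2).
Proof.
move=> pA pB le_s le_t.
have contr r : powmx A r <=L powmx B r ->
    powmx B (- (r / 2)) *m powmx A r *m powmx B (- (r / 2)) <=L 1%:M.
  move=> /(loewner_conj_herm (powmx_adj B (- (r / 2)))).
  rewrite (powmx_sandwich _ _ pB); have -> : - (r / 2) + r + - (r / 2) = 0 by lra.
  by rewrite (powmx0 pB).
set h := (s + t) / 2; pose N := powmx B (- (h / 2)).
suff le1 : N *m powmx A h *m N <=L 1%:M.
  have := loewner_conj_herm (powmx_adj B (h / 2)) le1.
  rewrite mulmx1 -(powmxD _ _ pB) -splitr !mulmxA (powmx_mulN _ pB) mul1mx.
  by rewrite -mulmxA (powmx_mulNr _ pB) mulmx1.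
have : posdefmx (N *m powmx A h *m N).
  have := posdef_conj (powmx_unit (- (h / 2)) pB) (powmx_posdef h pA).
  by rewrite powmx_adj.
move=> /posdef_spectral[U [d [uU d0 ME]]].
rewrite ME -(udiag1 uU); apply: udiag_le => j.
have Mu : N *m (powmx A h *m (N *m eigcol U j)) = (d j)%:C *: eigcol U j.
  by rewrite 2!mulmxA ME udiag_eigcol.
pose S := powmx A (s / 2) *m powmx B (- (s / 2)).
pose T := powmx B (- (t / 2)) *m powmx A (t / 2).
pose v := powmx B ((s - t) / 4) *m eigcol U j.
have TSv : (T *m S) *m v = (d j)%:C *: v.
  rewrite /v scalemxAr -Mu /T /S /N -!mulmxA.
  rewrite !(powmx_mulA _ _ _ pA) !(powmx_mulA _ _ _ pB).
  rewrite [X in powmx A X](_ : _ = h); last by rewrite /h; lra.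
  rewrite [X in powmx A h *m (powmx B X *m _)](_ : _ = - (h / 2)).
    by rewrite [X in _ = powmx B X *m _](_ : _ = - (t / 2)) // /h; lra.
  by rewrite /h; lra.
have qT : qform (T *m T^t*) v <= qform 1%:M v.
  have /loewner_qform[_ /(_ v)] := contr t le_t.
  rewrite /T adjmxM !powmx_adj -!mulmxA (powmx_mulA _ _ _ pA) -splitr; exact.
have qS : qform (S^t* *m S) v <= qform 1%:M v.
  have /loewner_qform[_ /(_ v)] := contr s le_s.
  rewrite /S adjmxM !powmx_adj -!mulmxA (powmx_mulA _ _ _ pA) -splitr; exact.
have v0 : 0 < qform 1%:M v.
  apply: qform1_gt0; apply: contra_neq (eigcol_neq0 j uU) => v0.
  by rewrite -[LHS](mulKmx (powmx_unit ((s - t) / 4) pB)) -/v v0 mulmx0.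
have := qform_mul_le T S v; rewrite (qform_eigen TSv) mulr2n => le2.
by rewrite -(ler_pM2r v0); lra.
Qed.

(** Bisection keeps [t] between two points of [P] at distance [2 ^- k]. *)
Lemma midpoint_dense (P : R -> Prop) : P 0 -> P 1 ->
  (forall s t, P s -> P t -> P ((s + t) / 2)) ->
  forall t, 0 <= t -> t <= 1 -> forall e, 0 < e -> exists2 s, P s & `|s - t| < e.
Proof.
move=> P0 P1 Pmid t t0 t1 e e0.
have [k ke] : exists k, 2 ^- k < e :> R.
  exists (Num.bound e^-1); rewrite -[ltRHS]invrK ltf_pV2 ?posrE ?exprn_gt0 ?invr_gt0 //.
  exact: upper_nthrootP.
suff [a [b [Pa Pb at_ tb ab]]] :
    exists a b, [/\ P a, P b, a <= t, t <= b & b - a = 2 ^- k].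
  by exists a => //; rewrite ler0_norm; lra.
elim: k {ke} => [|k [a [b [Pa Pb at_ tb ab]]]].
  by exists 0, 1; split=> //; rewrite subr0 expr0 invr1.
have Pc := Pmid _ _ Pa Pb.
have E : (2 ^- k.+1 : R) = 2 ^- k / 2 by rewrite exprS invfM mulrC.
have [ct|ct] := leP ((a + b) / 2) t.
  by exists ((a + b) / 2), b; split=> //; rewrite E -ab; lra.
by exists a, ((a + b) / 2); split=> //; [exact: ltW | rewrite E -ab; lra].
Qed.

Lemma continuous_powR_exponent (a : R) : 0 < a -> continuous (fun s : R => a `^ s).
Proof.
move=> a0 s; rewrite /powR gt_eqF //.
apply: (@continuous_comp _ _ _ (fun s : R => s * ln a) expR).
  by apply: cvgM; [exact: cvg_id | exact: cvg_cst].
exact: continuous_expR.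
Qed.

Lemma cvg_sumr T (F : set_system T) (FF : Filter F) I (r : seq I)
    (f : I -> T -> R) (a : I -> R) :
  (forall i, f i x @[x --> F] --> a i)%classic ->
  (\sum_(i <- r) f i x @[x --> F] --> \sum_(i <- r) a i)%classic.
Proof. by move=> fa; apply: cvg_big => //; exact: add_continuous. Qed.

Lemma continuous_qform_powmx m (A : 'M[C]_m) x : posdefmx A ->
  continuous (fun s => qform (powmx A s) x).
Proof.
move=> /posdef_spectral[U [d [uU d0 ->]]].
have -> : (fun s => qform (powmx (udiag U d) s) x) =
    (fun s => \sum_j d j `^ s * normsq ((U *m x) j 0)).
  by apply/funext => r; rewrite (powmx_udiag _ _ uU) qform_udiag.
move=> s; apply: cvg_sumr => j; apply: cvgM; last exact: cvg_cst.
exact: continuous_powR_exponent.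
Qed.

(** For a fixed vector, the difference of the two forms is continuous in the
    exponent; were it negative at [t], it would be negative at some nearby
    exponent for which the inequality is known. *)
Theorem loewner_heinz m (A B : 'M[C]_m) t : posdefmx A -> posdefmx B ->
  0 <= t -> t <= 1 -> A <=L B -> powmx A t <=L powmx B t.
Proof.
move=> pA pB t0 t1 AB.
apply: (proj2 (loewner_qform_herm (powmx_adj _ _) (powmx_adj _ _))) => x.
rewrite leNgt; apply/negP => lt_t.
pose g s := qform (powmx B s) x - qform (powmx A s) x.
have cg : continuous g.
  by move=> s; apply: cvgB; exact: continuous_qform_powmx.
have : (\forall s \near t, g s < 0)%classic.
  by apply: (cvgr_lt (g t) (cg t)); rewrite subr_lt0.
move=> /nbhs_ballP[e /= e0 near_t].
pose P s := powmx A s <=L powmx B s.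
have [||s t' Ps Pt'|s Ps st] := @midpoint_dense P _ _ _ t t0 t1 e e0.
- by rewrite /P (powmx0 pA) (powmx0 pB); exact: loewner_refl.
- by rewrite /P (powmx1 pA) (powmx1 pB).
- exact: loewner_heinz_midpoint pA pB Ps Pt'.
have : g s < 0 by apply: near_t; rewrite /ball /= distrC.
by have /loewner_qform[_ /(_ x)] := Ps; rewrite /g subr_lt0 leNgt => /negbTE ->.
Qed.

End LoewnerHeinz.

(** * Monotone limits and fixed points *)

(** The real bilinear form polarizing [qform]. *)
HB.lock Definition sform (R : realType) m (A : 'M[R[i]]_m) (x y : 'cV[R[i]]_m) : R :=
  complex.Re ((x^t* *m A *m y) 0 0).

Section MonotoneLimit.
Local Open Scope classical_set_scope.
Variable R : realType.
Local Notation C := R[i].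

Lemma sformDl m (A : 'M[C]_m) x y z : sform A (x + y) z = sform A x z + sform A y z.
Proof. by rewrite sform.unlock adjmxD !mulmxDl mxE complex_ReD. Qed.

Lemma sformDr m (A : 'M[C]_m) x y z : sform A x (y + z) = sform A x y + sform A x z.
Proof. by rewrite sform.unlock mulmxDr mxE complex_ReD. Qed.

Lemma sformxx m (A : 'M[C]_m) x : sform A x x = qform A x.
Proof. by rewrite sform.unlock qform.unlock. Qed.

Lemma sformC m (A : 'M[C]_m) x y : A^t* = A -> sform A y x = sform A x y.
Proof.
move=> hA; have E : y^t* *m A *m x = (x^t* *m A *m y)^t*.
  by rewrite !adjmxM adjmxK hA mulmxA.
by rewrite sform.unlock E adjmxE complex_Re_conj.
Qed.

Lemma sform_polar m (A : 'M[C]_m) x y : A^t* = A ->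
  sform A x y = (qform A (x + y) - qform A x - qform A y) / 2.
Proof.
move=> hA; rewrite -(sformxx A (x + y)) sformDl !sformDr (sformC x y hA) !sformxx.
by field.
Qed.

Lemma sform_delta m (A : 'M[C]_m) i (j : 'I_m) (c : C) :
  sform A (delta_mx i 0) (c *: delta_mx j 0) = complex.Re (c * A i j).
Proof.
rewrite sform.unlock; have -> : (delta_mx i 0 : 'cV[C]_m)^t* = delta_mx 0 i.
  by rewrite adjmx.unlock trmx_delta map_delta_mx.
by rewrite -rowE -scalemxAr -colE !mxE.
Qed.

Lemma qform_entries m (A : 'M[C]_m) x : qform A x =
  \sum_j \sum_i (complex.Re ((x i 0)^*%R * x j 0) * complex.Re (A i j)
    - complex.Im ((x i 0)^*%R * x j 0) * complex.Im (A i j)).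
Proof.
rewrite qform.unlock mxE complex_Re_sum; apply: eq_bigr => j _.
rewrite mxE mulr_suml complex_Re_sum; apply: eq_bigr => i _.
rewrite adjmxE mulrAC.
by case: (_ * x j 0) => a b; case: (A i j) => /= c d.
Qed.

(** The quadratic forms are monotone bounded real sequences, hence converge; by
    polarization so does every entry.  The last clause upgrades the convergence
    to the order: [L - X k] is positive semidefinite, hence dominated by its
    trace, which tends to 0. *)
Lemma loewner_monotone_limit m (X : nat -> 'M[C]_m) (B : 'M[C]_m) :
  (forall k, (X k)^t* = X k) -> (forall k, X k <=L X k.+1) -> (forall k, X k <=L B) ->
  exists L, [/\ forall k, X k <=L L,
    forall D, (forall k, X k <=L D) -> L <=L D &
    forall e, 0 < e -> exists k, L - e%:C *: 1%:M <=L X k].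
Proof.
move=> hX incX leB.
have ndq x : nondecreasing_seq (fun k => qform (X k) x).
  by apply/nondecreasing_seqP => k; have /loewner_qform[_] := incX k.
have cvq x : cvgn (fun k => qform (X k) x).
  apply: nondecreasing_is_cvgn => //; exists (qform B x) => _ [k _ <-].
  by have /loewner_qform[_] := leB k.
have cvs x y : cvgn (fun k => sform (X k) x y).
  have -> : (fun k => sform (X k) x y) =
      (fun k => (qform (X k) (x + y) - qform (X k) x - qform (X k) y) / 2).
    by apply/funext => k; rewrite sform_polar.
  by apply: is_cvgM; [apply: is_cvgB; [apply: is_cvgB|]|exact: is_cvg_cst].
have cvRe i j : cvgn (fun k => complex.Re (X k i j)).
  suff <- : (fun k => sform (X k) (delta_mx i 0) (1 *: delta_mx j 0)) =
      (fun k => complex.Re (X k i j)) by exact: cvs.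
  by apply/funext => k; rewrite sform_delta mul1r.
(* The factor - 'i turns the imaginary part of an entry into a real part. *)
have cvIm i j : cvgn (fun k => complex.Im (X k i j)).
  suff <- : (fun k => sform (X k) (delta_mx i 0) ((- 'i%C) *: delta_mx j 0)) =
      (fun k => complex.Im (X k i j)) by exact: cvs.
  apply/funext => k; rewrite sform_delta.
  by case: (X k i j) => a b /=; rewrite oppr0 mul0r sub0r mulN1r opprK.
pose L : 'M[C]_m := \matrix_(i, j)
  Complex (limn (fun k => complex.Re (X k i j))) (limn (fun k => complex.Im (X k i j))).
have cvL x : (fun k => qform (X k) x) @ \oo --> qform L x.
  rewrite qform_entries; under eq_cvg do rewrite qform_entries.
  apply: cvg_sumr => j; apply: cvg_sumr => i.
  have [-> ->] : complex.Re (L i j) = limn (fun k => complex.Re (X k i j)) /\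
      complex.Im (L i j) = limn (fun k => complex.Im (X k i j)) by rewrite mxE.
  by apply: cvgB; (apply: cvgM; [exact: cvg_cst |]); [exact: cvRe | exact: cvIm].
have hL : L^t* = L.
  have hXij k i j : X k i j = (X k j i)^*%R by rewrite -{1}(hX k) adjmxE.
  apply/matrixP => i j; rewrite adjmxE !mxE.
  have -> : (fun k => complex.Re (X k i j)) = (fun k => complex.Re (X k j i)).
    by apply/funext => k; rewrite hXij complex_Re_conj.
  have -> // : limn (fun k => complex.Im (X k i j)) =
      - limn (fun k => complex.Im (X k j i)).
  apply/cvg_lim => //.
  have -> : (fun k => complex.Im (X k i j)) = (fun k => - complex.Im (X k j i)).
    by apply/funext => k; rewrite hXij; case: (X k j i).
  by apply: cvgN; exact: cvIm.
have XL k : X k <=L L.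
  apply: (proj2 (loewner_qform_herm (hX k) hL)) => x.
  rewrite -(cvg_lim (@Rhausdorff R) (cvL x)).
  exact: nondecreasing_cvgn_le.
exists L; split=> //.
- move=> D XD.
  have hD : D^t* = D.
    have /loewner_qform[h _] := XD 0%N.
    by rewrite -[D](subrK (X 0%N)) adjmxD h hX.
  apply: (proj2 (loewner_qform_herm hL hD)) => x.
  apply: (cvgr_to_le (cvL x)); apply: nearW => k.
  by have /loewner_qform[_] := XD k.
- move=> e e0.
  have tr_cvg : (fun k => \sum_j (complex.Re (L j j) - complex.Re (X k j j))) @ \oo -->
      \sum_(j < m) (complex.Re (L j j) - complex.Re (L j j)).
    apply: cvg_sumr => j; apply: cvgB; first exact: cvg_cst.
    have -> : complex.Re (L j j) = limn (fun k => complex.Re (X k j j)) by rewrite mxE.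
    exact: cvRe.
  have tr_lt : \sum_(j < m) (complex.Re (L j j) - complex.Re (L j j)) < e.
    by rewrite big1 // => j _; rewrite subrr.
  have [k _ /(_ k (leqnn k)) /= trk] := cvgr_lt _ tr_cvg _ tr_lt.
  have {}trk : \sum_j complex.Re ((L - X k) j j) < e.
    suff -> : \sum_j complex.Re ((L - X k) j j) =
        \sum_j (complex.Re (L j j) - complex.Re (X k j j)) by [].
    apply: eq_bigr => j _; rewrite [(L - X k) j j]mxE complex_ReD [(- X k) j j]mxE.
    by case: (X k j j).
  exists k; have /loewner_qform[_ q] := loewner_trace (XL k).
  have h1 : (L - e%:C *: 1%:M)^t* = L - e%:C *: 1%:M.
    by rewrite adjmxB adjmxZ hL adjmx1.
  apply: (proj2 (loewner_qform_herm h1 (hX k))) => x.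
  have := q x; rewrite !qformB !qformZ => qx.
  have q1 : 0 <= qform 1%:M x.
    by rewrite qform1 sumr_ge0 // => j _; exact: normsq_ge0.
  have := ler_wpM2r q1 (ltW trk).
  by move: qx; move: (\sum_j _) => T; lra.
Qed.

Lemma posdef_lower m (A : 'M[C]_m) : posdefmx A ->
  exists2 c : R, 0 < c & c%:C *: 1%:M <=L A.
Proof.
move=> /posdef_spectral[U [d [uU d0 ->]]].
have S0 : 0 <= \sum_j (d j)^-1 by rewrite sumr_ge0 // => j _; rewrite invr_ge0 ltW.
have S1 : 0 < 1 + \sum_j (d j)^-1 by rewrite ltr_wpDr.
exists (1 + \sum_j (d j)^-1)^-1; first by rewrite invr_gt0.
rewrite -(udiag_const _ uU); apply: udiag_le => j.
rewrite invf_ple ?posrE // (bigD1 j) //= addrCA lerDl addr_ge0 //.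
by rewrite sumr_ge0 // => i _; rewrite invr_ge0 ltW.
Qed.

Lemma loewner_scale1 m (c d : R) : c <= d ->
  c%:C *: 1%:M <=L d%:C *: (1%:M : 'M[C]_m).
Proof.
move=> cd; have /posdef_spectral[U [e [uU _ _]]] := posdef1 R m.
by rewrite -!(udiag_const _ uU); apply: udiag_le.
Qed.

(** The common bound is the inverse of the sum of the inverse bounds, with 1
    added to cover the empty family. *)
Lemma posdef_family_lower m n (A : 'I_n -> 'M[C]_m) : (forall i, posdefmx (A i)) ->
  exists2 c : R, 0 < c & forall i, c%:C *: 1%:M <=L A i.
Proof.
move=> pA.
have /fin_all_exists[c hc] i : exists c : R, 0 < c /\ c%:C *: 1%:M <=L A i.
  by have [c] := posdef_lower (pA i); exists c.
have c0 i : 0 < c i by case: (hc i).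
have S0 : 0 <= \sum_i (c i)^-1 by rewrite sumr_ge0 // => j _; rewrite invr_ge0 ltW.
have S1 : 0 < 1 + \sum_i (c i)^-1 by rewrite ltr_wpDr.
exists (1 + \sum_j (c j)^-1)^-1; first by rewrite invr_gt0.
move=> i; apply: loewner_trans (proj2 (hc i)); apply: loewner_scale1.
rewrite invf_ple ?posrE // (bigD1 i) //= addrCA lerDl addr_ge0 //.
by rewrite sumr_ge0 // => j _; rewrite invr_ge0 ltW.
Qed.

(** A lower bound for the inverses is an upper bound for the matrices. *)
Lemma posdef_family_upper m n (A : 'I_n -> 'M[C]_m) : (forall i, posdefmx (A i)) ->
  exists2 c : R, 0 < c & forall i, A i <=L c%:C *: 1%:M.
Proof.
move=> pA; have pI i := powmx_posdef (-1) (pA i).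
have [c c0 cA] := posdef_family_lower pI; exists c^-1; first by rewrite invr_gt0.
move=> i; have := loewner_conj_herm (powmx_adj (A i) 2^-1) (cA i).
rewrite (powmx_sandwich _ _ (pA i)) -scalemxAr mulmx1 -scalemxAl -(powmxD _ _ (pA i)).
have -> : 2^-1 + 2^-1 = 1 :> R by lra.
have -> : 2^-1 + -1 + 2^-1 = 0 :> R by lra.
rewrite (powmx0 (pA i)) (powmx1 (pA i)) => /(loewner_scale (ltW (_ : 0 < c^-1))).
rewrite scalerA -rmorphM mulVf ?gt_eqF // scale1r; apply.
by rewrite invr_gt0.
Qed.

(** The iterates of [X0] increase to some [L], and monotonicity gives
    [L <= f L].  For the converse, homogeneity stands in for continuity: for every
    [e] in (0, 1) some iterate dominates [(1 - e) L], so that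
    [(1 - e) f L <= (1 - e)^q f L = f ((1 - e) L) <= L]; let [e] tend to 0. *)
Lemma monotone_homogeneous_fixpoint m (f : 'M[C]_m -> 'M[C]_m) q X0 B :
  (forall X, posdefmx X -> posdefmx (f X)) ->
  (forall X Y, posdefmx X -> posdefmx Y -> X <=L Y -> f X <=L f Y) ->
  (forall c X, 0 < c -> posdefmx X -> f (c%:C *: X) = (c `^ q)%:C *: f X) ->
  q <= 1 -> posdefmx X0 -> X0 <=L f X0 -> X0 <=L B -> f B <=L B ->
  exists2 X, posdefmx X & f X = X.
Proof.
move=> fpos fmono fhom q1 pX0 X0f X0B fB.
have pB := posdef_loewner pX0 X0B.
pose X k := iter k f X0.
have pX k : posdefmx (X k) by elim: k => [|k IH]; [exact: pX0 | exact: fpos IH].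
have incX k : X k <=L X k.+1.
  by elim: k => [|k IH]; [exact: X0f | exact: fmono (pX k) (pX k.+1) IH].
have leB k : X k <=L B.
  elim: k => [|k IH]; first exact: X0B.
  exact: loewner_trans (fmono _ _ (pX k) pB IH) fB.
have hX k := posdef_adj (pX k).
have [L [XL Lmin Lclose]] := loewner_monotone_limit hX incX leB.
have pL := posdef_loewner (pX 0%N) (XL 0%N).
exists L => //; apply: loewner_antisym; last first.
  apply: Lmin => k; apply: loewner_trans (incX k) _.
  exact: fmono (pX k) pL (XL k).
have [c c0 cL] := posdef_lower pL.
have near1 e : 0 < e -> e < 1 -> (1 - e)%:C *: f L <=L L.
  move=> e0 e1; have s0 : 0 < 1 - e by lra.
  (* The additive error [e * c] is absorbed by [e L], as [c <= L]. *)
  have [k hk] := Lclose (e * c) (mulr_gt0 e0 c0).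
  have le_k : (1 - e)%:C *: L <=L X k.
    apply: loewner_trans hk.
    have h1 := posdef_adj (posdef_scale s0 pL).
    have h2 : (L - (e * c)%:C *: 1%:M)^t* = L - (e * c)%:C *: 1%:M.
      by rewrite adjmxB adjmxZ (posdef_adj pL) adjmx1.
    apply: (proj2 (loewner_qform_herm h1 h2)) => x.
    have /loewner_qform[_ /(_ x)] := cL; rewrite qformB !qformZ.
    move: (qform L x) (qform 1%:M x) => a b h; have := ler_wpM2l (ltW e0) h.
    by lra.
  have := fmono _ _ (posdef_scale s0 pL) (pX k) le_k.
  rewrite (fhom _ _ s0 pL) => h; have {}h := loewner_trans h (XL k.+1).
  apply: loewner_trans h; have pfL := fpos _ pL.
  have h1 := posdef_adj (posdef_scale s0 pfL).
  have s0q : 0 < (1 - e) `^ q by rewrite powR_gt0.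
  have h2 := posdef_adj (posdef_scale s0q pfL).
  apply: (proj2 (loewner_qform_herm h1 h2)) => x; rewrite !qformZ ler_wpM2r //.
    by have /posdef_possemidef/possemidef_qform[_] := pfL.
  by rewrite ger1_powR //; lra.
have pfL := fpos _ pL.
apply: (proj2 (loewner_qform_herm (posdef_adj pfL) (posdef_adj pL))) => x.
rewrite leNgt; apply/negP => lt_x.
have qL : 0 <= qform L x by have /posdef_possemidef/possemidef_qform[_] := pL.
set a := qform (f L) x in lt_x; set b := qform L x in lt_x qL.
have a0 : 0 < a by exact: le_lt_trans lt_x.
have a20 : 0 < a * 2 by rewrite mulr_gt0.
(* This [e] makes [(1 - e) * a] the midpoint of [a] and [b]. *)
have := near1 ((a - b) / (a * 2)); rewrite divr_gt0 ?subr_gt0 //.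
rewrite ltr_pdivrMr // mul1r => /(_ isT); have -> : a - b < a * 2 by lra.
move=> /(_ isT)/loewner_qform[_ /(_ x)]; rewrite qformZ -/a -/b.
have -> : (1 - (a - b) / (a * 2)) * a = (a + b) / 2 by field; rewrite gt_eqF.
by lra.
Qed.

End MonotoneLimit.

(** * Weighted geometric means *)

(** [gmean], locked for the same reason as the operations above. *)
HB.lock Definition wgmean (R : realType) m (t : R) (A B : 'M[R[i]]_m) : 'M[R[i]]_m :=
  gmean t A B.

Section PowerMean.
Variable R : realType.
Local Notation C := R[i].

Lemma posdef_sandwich m (A K : 'M[C]_m) r : posdefmx A -> posdefmx K ->
  posdefmx (powmx K r *m A *m powmx K r).
Proof.
by move=> pA pK; have := posdef_conj (powmx_unit r pK) pA; rewrite powmx_adj.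
Qed.

Lemma wgmeanE m t (A B : 'M[C]_m) : wgmean t A B =
  powmx A 2^-1 *m powmx (powmx A (- 2^-1) *m B *m powmx A (- 2^-1)) t *m powmx A 2^-1.
Proof. by rewrite wgmean.unlock powmx.unlock. Qed.

Lemma wgmean_posdef m t (A B : 'M[C]_m) : posdefmx A -> posdefmx B ->
  posdefmx (wgmean t A B).
Proof.
move=> pA pB; rewrite wgmeanE.
exact: posdef_sandwich (powmx_posdef t (posdef_sandwich _ pB pA)) pA.
Qed.

Lemma half_add : 2^-1 + 2^-1 = 1 :> R.
Proof. by lra. Qed.

Lemma powmx_half_sqr m (A : 'M[C]_m) : posdefmx A -> powmx A 2^-1 *m powmx A 2^-1 = A.
Proof. by move=> pA; rewrite -(powmxD _ _ pA) half_add (powmx1 pA). Qed.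

Lemma powmx_neghalf_sandwich m (A : 'M[C]_m) : posdefmx A ->
  powmx A (- 2^-1) *m A *m powmx A (- 2^-1) = 1%:M.
Proof.
move=> pA; rewrite -{2}(powmx1 pA) (powmx_sandwich _ _ pA).
have -> : - 2^-1 + 1 + - 2^-1 = 0 :> R by lra.
exact: powmx0.
Qed.

Lemma wgmean_id m t (A : 'M[C]_m) : posdefmx A -> wgmean t A A = A.
Proof.
move=> pA.
by rewrite wgmeanE (powmx_neghalf_sandwich pA) powmx1l mulmx1 (powmx_half_sqr pA).
Qed.

Lemma wgmean_monor m t (A B D : 'M[C]_m) : posdefmx A -> posdefmx B -> posdefmx D ->
  0 <= t -> t <= 1 -> B <=L D -> wgmean t A B <=L wgmean t A D.
Proof.
move=> pA pB pD t0 t1 BD; rewrite !wgmeanE; apply: loewner_conj_herm (powmx_adj _ _) _.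
apply: (loewner_heinz (posdef_sandwich _ pB pA) (posdef_sandwich _ pD pA) t0 t1).
exact: loewner_conj_herm (powmx_adj _ _) BD.
Qed.

Lemma powmx_inverse m (W V : 'M[C]_m) : posdefmx W -> W *m V = 1%:M -> V = powmx W (-1).
Proof.
move=> pW WV; rewrite -(mul1mx V) -(powmx_mulNr 1 pW) -mulmxA (powmx1 pW) WV.
by rewrite mulmx1.
Qed.

(** With [Y = A^(-1/2) B^(1/2)], the left side is [A^(1/2) (Y Y^t* )^t A^(1/2)].
    By [powmx_mul_adj] it equals [B^(1/2) (Y^t* Y)^(t-1) B^(1/2)], and [Y^t* Y]
    is the inverse of [B^(-1/2) A B^(-1/2)].  Symmetry carries over to the first
    argument what is immediate in the second. *)
Lemma wgmean_sym m t (A B : 'M[C]_m) : posdefmx A -> posdefmx B ->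
  wgmean t A B = wgmean (1 - t) B A.
Proof.
move=> pA pB; pose Y := powmx A (- 2^-1) *m powmx B 2^-1.
have YY : Y *m Y^t* = powmx A (- 2^-1) *m B *m powmx A (- 2^-1).
  by rewrite /Y adjmxM !powmx_adj -mulmxA (mulmxA (powmx B _)) (powmx_half_sqr pB) mulmxA.
have AY : powmx A 2^-1 *m Y = powmx B 2^-1.
  by rewrite /Y mulmxA (powmx_mulN _ pA) mul1mx.
have YA : Y^t* *m powmx A 2^-1 = powmx B 2^-1.
  by rewrite -[X in _ *m X](powmx_adj A) -adjmxM AY powmx_adj.
have uY : Y \in unitmx.
  by rewrite unitmx_mul (powmx_unit _ pA) (powmx_unit _ pB).
pose W := powmx B (- 2^-1) *m A *m powmx B (- 2^-1).
have pW : posdefmx W by exact: (posdef_sandwich _ pA pB).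
have WV : W *m (Y^t* *m Y) = 1%:M.
  rewrite /W /Y -[X in _ *m X *m _ *m _](powmx1 pA) adjmxM !powmx_adj -!mulmxA.
  rewrite (powmx_mulA _ _ _ pB) addNr (powmx0 pB) mul1mx !(powmx_mulA _ _ _ pA).
  have -> : 1 - 2^-1 - 2^-1 = 0 :> R by lra.
  by rewrite (powmx0 pA) mul1mx (powmx_mulNr _ pB).
have := powmx_mul_adj (t - 1) uY; rewrite subrK YY => polar.
rewrite (wgmeanE t A B) polar; clearbody Y.
rewrite !mulmxA AY -mulmxA YA (powmx_inverse pW WV) (powmxrM _ _ pW).
rewrite (wgmeanE (1 - t) B A).
by have -> : -1 * (t - 1) = 1 - t by ring.
Qed.

Lemma wgmean_monol m t (A B D : 'M[C]_m) : posdefmx A -> posdefmx B -> posdefmx D ->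
  0 <= t -> t <= 1 -> A <=L B -> wgmean t A D <=L wgmean t B D.
Proof.
move=> pA pB pD t0 t1 AB; rewrite (wgmean_sym t pA pD) (wgmean_sym t pB pD).
by apply: wgmean_monor; rewrite ?subr_ge0 // gerBl.
Qed.

Lemma wgmean_scalel m t c (A B : 'M[C]_m) : 0 < c -> posdefmx A -> posdefmx B ->
  wgmean t (c%:C *: A) B = (c `^ (1 - t))%:C *: wgmean t A B.
Proof.
move=> c0 pA pB; rewrite (wgmean_sym t pA pB) (wgmean_sym t (posdef_scale c0 pA) pB).
rewrite !wgmeanE -scalemxAr -scalemxAl (powmx_scale _ c0 (posdef_sandwich _ pA pB)).
by rewrite -scalemxAr -scalemxAl.
Qed.

(** * The power mean as a fixed point *)

(** The map whose fixed point is the power mean. *)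
Definition pmean_map m n t (w : 'I_n -> R) (A : 'I_n -> 'M[C]_m) (X : 'M[C]_m) :=
  \sum_i (w i)%:C *: wgmean t X (A i).

Lemma weighted_const m n (w : 'I_n -> R) (M : 'M[C]_m) : prob_vec w ->
  \sum_i (w i)%:C *: M = M.
Proof. by move=> [_ w1]; rewrite -scaler_suml -rmorph_sum w1 scale1r. Qed.

Lemma weighted_mono m n (w : 'I_n -> R) (F G : 'I_n -> 'M[C]_m) : prob_vec w ->
  (forall i, F i <=L G i) -> \sum_i (w i)%:C *: F i <=L \sum_i (w i)%:C *: G i.
Proof.
move=> [w0 _] FG; apply: loewner_sum => i.
exact: loewner_scale (ltW (w0 i)) (FG i).
Qed.

Lemma pmean_map_posdef m n t (w : 'I_n -> R) (A : 'I_n -> 'M[C]_m) X : prob_vec w ->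
  (forall i, posdefmx (A i)) -> posdefmx X -> posdefmx (pmean_map t w A X).
Proof.
move=> hw pA pX.
have [c c0 le_c] := posdef_family_lower (fun i => wgmean_posdef t pX (pA i)).
apply: posdef_loewner (posdef_scale c0 (posdef1 R m)) _.
rewrite -[X in X <=L _](weighted_const _ hw).
exact: weighted_mono hw le_c.
Qed.

Lemma pmean_map_mono m n t (w : 'I_n -> R) (A : 'I_n -> 'M[C]_m) X Y : prob_vec w ->
  (forall i, posdefmx (A i)) -> 0 <= t -> t <= 1 -> posdefmx X -> posdefmx Y ->
  X <=L Y -> pmean_map t w A X <=L pmean_map t w A Y.
Proof.
move=> hw pA t0 t1 pX pY XY; apply: (weighted_mono hw) => i.
exact: wgmean_monol pX pY (pA i) t0 t1 XY.
Qed.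

Lemma pmean_map_scale m n t (w : 'I_n -> R) (A : 'I_n -> 'M[C]_m) c X :
  (forall i, posdefmx (A i)) -> 0 < c -> posdefmx X ->
  pmean_map t w A (c%:C *: X) = (c `^ (1 - t))%:C *: pmean_map t w A X.
Proof.
move=> pA c0 pX; rewrite /pmean_map scaler_sumr; apply: eq_bigr => i _.
by rewrite (wgmean_scalel t c0 pX (pA i)) !scalerA mulrC.
Qed.

(** The scalar matrices below and above all [A i] start and bound the
    iteration, because [c #_t c = c] and the mean is monotone. *)
Lemma pmean_map_fixpoint m n t (w : 'I_n -> R) (A : 'I_n -> 'M[C]_m) : prob_vec w ->
  (forall i, posdefmx (A i)) -> 0 < t -> t <= 1 ->
  exists2 X, posdefmx X & pmean_map t w A X = X.
Proof.
move=> hw pA t0 t1; have t0' := ltW t0.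
have [c c0 cA] := posdef_family_lower pA.
have [d d0 Ad] := posdef_family_upper pA.
have pc := posdef_scale c0 (posdef1 R m).
have le_cd : c%:C *: 1%:M <=L (c + d)%:C *: (1%:M : 'M[C]_m).
  by apply: loewner_scale1; rewrite lerDl ltW.
have pcd := posdef_loewner pc le_cd.
apply: (monotone_homogeneous_fixpoint (q := 1 - t) (X0 := c%:C *: 1%:M)
  (B := (c + d)%:C *: 1%:M) _ _ _ _ pc _ le_cd).
- by move=> X; exact: pmean_map_posdef hw pA.
- by move=> X Y; exact: pmean_map_mono hw pA t0' t1.
- by move=> e X; exact: pmean_map_scale pA.
- by rewrite gerBl.
- rewrite -[X in X <=L _](weighted_const _ hw); apply: (weighted_mono hw) => i.
  rewrite -[X in X <=L _](wgmean_id t pc).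
  exact: (wgmean_monor pc pc (pA i) t0' t1 (cA i)).
- rewrite -[X in _ <=L X](weighted_const _ hw); apply: (weighted_mono hw) => i.
  rewrite -[X in _ <=L X](wgmean_id t pcd).
  apply: (wgmean_monor pcd (pA i) pcd t0' t1).
  apply: loewner_trans (Ad i) _; apply: loewner_scale1.
  by rewrite lerDr ltW.
Qed.

Lemma power_mean_posP m n t (w : 'I_n -> R) (A : 'I_n -> 'M[C]_m) : prob_vec w ->
  (forall i, posdefmx (A i)) -> 0 < t -> t <= 1 ->
  posdefmx (power_mean_pos t w A) /\
  pmean_map t w A (power_mean_pos t w A) = power_mean_pos t w A.
Proof.
move=> hw pA t0 t1.
have pm_eq X : power_mean_eq t w A X <-> posdefmx X /\ pmean_map t w A X = X.
  by rewrite /power_mean_eq /pmean_map wgmean.unlock; split=> -[? ?]; split.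
apply: (proj1 (pm_eq _)); rewrite /power_mean_pos.
have [X pX fX] := pmean_map_fixpoint hw pA t0 t1.
exact: (xgetPex 1%:M (ex_intro _ X (proj2 (pm_eq X) (conj pX fX)))).
Qed.

(** * Comparison for powers of the matrices *)

(** Bernoulli's inequality on the spectrum; the scalar case is Young's
    inequality for [x] and 1 with exponent [p]. *)
Lemma powmx_bernoulli m (A : 'M[C]_m) p : posdefmx A -> 1 <= p ->
  1%:M + p%:C *: (A - 1%:M) <=L powmx A p.
Proof.
move=> /posdef_spectral[U [d [uU d0 ->]]] p1.
have -> : 1%:M + p%:C *: (udiag U d - 1%:M) = udiag U (fun j => 1 + p * (d j - 1)).
  rewrite -(udiag1 uU) -scaleN1r.
  have -> : (-1 : C) = (-1 : R)%:C by rewrite rmorphN.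
  by rewrite !(udiagZ, udiagD); apply: eq_udiag => j; rewrite mulr1.
rewrite (powmx_udiag _ _ uU); apply: udiag_le => j.
move: (d j) (d0 j) => x x0.
have [->|p_neq1] := eqVneq p 1; first by rewrite (powRr1 (ltW x0)); lra.
have p0 : 0 < p by exact: lt_le_trans p1.
have p1' : 1 < p by rewrite lt_neqAle eq_sym p_neq1.
have pV1 : p^-1 < 1 by rewrite invf_lt1.
have q0 : 0 < (1 - p^-1)^-1 by rewrite invr_gt0 subr_gt0.
have := conjugate_powR (ltW x0) ler01 p0 q0.
rewrite invrK addrC subrK => /(_ erefl); rewrite powR1 mulr1 mul1r => young.
have := ler_wpM2l (ltW p0) young.
rewrite mulrDr mulrCA divff ?gt_eqF // mulr1 mulrBr divff ?gt_eqF //.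
by lra.
Qed.

Lemma powR_lt_self (a t : R) : 1 < a -> 0 < t -> a `^ (1 - t) < a.
Proof.
move=> a1 t0; have a0 : 0 < a by exact: lt_trans a1.
have at1 : 1 < a `^ t.
  have -> : 1 = 1 `^ t :> R by rewrite powR1.
  by apply: gt0_ltr_powR; rewrite // nnegrE ltW.
have aE : a `^ (1 - t) * a `^ t = a.
  by rewrite -powRD ?subrK ?powRr1 ?ltW // (gt_eqF a0) implybT.
by rewrite -[ltRHS]aE ltr_pMr // powR_gt0.
Qed.

(** If the largest eigenvalue [d k] of [Y^(-1/2) X Y^(-1/2)] exceeded 1, then
    [X <= d k Y] would improve, after one application of the map, to
    [X <= (d k)^(1-t) Y] with the smaller factor [(d k)^(1-t) < d k]. *)
Lemma pmean_map_subfixpoint_le m n t (w : 'I_n -> R) (A : 'I_n -> 'M[C]_m) X Y :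
  prob_vec w -> (forall i, posdefmx (A i)) -> 0 < t -> t <= 1 -> posdefmx X -> posdefmx Y ->
  X <=L pmean_map t w A X -> pmean_map t w A Y = Y -> X <=L Y.
Proof.
move=> hw pA t0 t1 pX pY Xf fY.
have pM := posdef_sandwich (- 2^-1) pX pY.
have scaleM Z c : Z <=L c%:C *: Y <->
    powmx Y (- 2^-1) *m Z *m powmx Y (- 2^-1) <=L c%:C *: 1%:M.
  split.
    move=> /(loewner_conj_herm (powmx_adj Y (- 2^-1))).
    by rewrite -scalemxAr -scalemxAl (powmx_neghalf_sandwich pY).
  move=> /(loewner_conj_herm (powmx_adj Y 2^-1)).
  rewrite !mulmxA (powmx_mulN _ pY) mul1mx -mulmxA (powmx_mulNr _ pY) mulmx1.
  by rewrite -scalemxAr mulmx1 -scalemxAl (powmx_half_sqr pY).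
have [U [d [uU d0 ME]]] := posdef_spectral pM.
suff d1 j : d j <= 1.
  rewrite -(scale1r Y); apply: (proj2 (scaleM X 1)).
  by rewrite ME -(udiag_const _ uU); apply: udiag_le.
have /= dmax := @arg_maxP _ _ _ j xpredT d isT.
case: dmax => k _ kmax; apply: le_trans (kmax j isT) _.
rewrite leNgt; apply/negP => dk1.
have Xk : X <=L (d k)%:C *: Y.
  apply: (proj2 (scaleM _ _)); rewrite ME -(udiag_const _ uU).
  by apply: udiag_le => i; exact: kmax.
have := pmean_map_mono hw pA (ltW t0) t1 pX (posdef_scale (d0 k) pY) Xk.
rewrite (pmean_map_scale _ _ pA (d0 k) pY) fY => /(loewner_trans Xf).
move=> /(proj1 (scaleM _ _)); rewrite ME -(udiag_const _ uU) => /(udiag_le_inv uU)/(_ k).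
by apply/negP; rewrite -ltNge; exact: powR_lt_self.
Qed.

(** Write [K A K^t* = Y Y^t*] with [Y = K A^(1/2)].  Then
    [(Y Y^t* )^p = Y (Y^t* Y)^(p-1) Y^t*], and since [Y^t* Y <= A] and
    [0 <= p - 1 <= 1], Loewner-Heinz bounds the middle factor by [A^(p-1)]. *)
Lemma powmx_hansen m (A K : 'M[C]_m) p : posdefmx A -> K \in unitmx ->
  K^t* *m K <=L 1%:M -> 1 <= p -> p <= 2 ->
  powmx (K *m A *m K^t*) p <=L K *m powmx A p *m K^t*.
Proof.
move=> pA uK KK p1 p2; pose Y := K *m powmx A 2^-1.
have Yadj : Y^t* = powmx A 2^-1 *m K^t* by rewrite /Y adjmxM powmx_adj.
have uY : Y \in unitmx by rewrite unitmx_mul uK (powmx_unit _ pA).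
have YY : Y *m Y^t* = K *m A *m K^t*.
  by rewrite Yadj /Y -mulmxA (mulmxA (powmx A _)) (powmx_half_sqr pA) mulmxA.
have YYle : Y^t* *m Y <=L A.
  have := loewner_conj_herm (powmx_adj A 2^-1) KK.
  by rewrite mulmx1 (powmx_half_sqr pA) Yadj /Y !mulmxA.
have := powmx_mul_adj (p - 1) uY; rewrite subrK YY => ->.
have p10 : 0 <= p - 1 by lra.
have p11 : p - 1 <= 1 by lra.
have := loewner_heinz (posdef_adj_mul uY) pA p10 p11 YYle.
move=> /(loewner_conj (Y^t*)); rewrite adjmxK => hY.
apply: loewner_trans hY _; rewrite Yadj /Y -!mulmxA !(powmx_mulA _ _ _ pA).
have -> : 2^-1 + (p - 1) + 2^-1 = p by lra.
exact: loewner_refl.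
Qed.

(** By [powmx_hansen], Loewner-Heinz and Bernoulli,
    [(K A_i^p K)^t >= 1 + p (Z_i^t - 1)] with [K = X^(-1/2)] and
    [Z_i = K A_i K].  The weighted mean of the right side is 1, since the fixed
    point equation says that the [Z_i^t] have weighted mean 1. *)
Lemma pmean_map_pow_ge m n t p (w : 'I_n -> R) (A : 'I_n -> 'M[C]_m) X : prob_vec w ->
  (forall i, posdefmx (A i)) -> 0 < t -> t <= 1 -> 1 <= p -> p <= 2 ->
  posdefmx X -> pmean_map t w A X = X -> 1%:M <=L X ->
  X <=L pmean_map t w (fun i => powmx (A i) p) X.
Proof.
move=> hw pA t0 t1 p1 p2 pX fX X1.
pose K := powmx X (- 2^-1).
have hK : K^t* = K by exact: powmx_adj.
have uK : K \in unitmx by exact: powmx_unit.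
have KK : K *m K <=L 1%:M.
  have := loewner_conj_herm hK X1.
  by rewrite mulmx1 (powmx_neghalf_sandwich pX).
pose Z i := K *m A i *m K.
have pZ i : posdefmx (Z i) by exact: (posdef_sandwich _ (pA i) pX).
have sumZ : \sum_i (w i)%:C *: powmx (Z i) t = 1%:M.
  rewrite -(powmx_neghalf_sandwich pX) -[X in _ *m X *m _]fX /pmean_map.
  rewrite mulmx_sumr mulmx_suml; apply: eq_bigr => i _.
  rewrite -scalemxAr -scalemxAl wgmeanE -!mulmxA (powmx_mulN _ pX) mulmx1.
  by rewrite (mulmxA (powmx X _)) (powmx_mulNr _ pX) mul1mx /Z /K !mulmxA.
have hansen i : powmx (Z i) p <=L K *m powmx (A i) p *m K.
  have KK' : K^t* *m K <=L 1%:M by rewrite hK.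
  by have := powmx_hansen (pA i) uK KK' p1 p2; rewrite hK.
have pZp i : posdefmx (K *m powmx (A i) p *m K).
  exact: posdef_sandwich (powmx_posdef _ (pA i)) pX.
have step i : 1%:M + p%:C *: (powmx (Z i) t - 1%:M)
    <=L powmx (K *m powmx (A i) p *m K) t.
  have := powmx_bernoulli (powmx_posdef t (pZ i)) p1.
  rewrite (powmxrM _ _ (pZ i)) mulrC -(powmxrM _ _ (pZ i)) => bern.
  apply: loewner_trans bern _.
  exact: loewner_heinz (powmx_posdef p (pZ i)) (pZp i) (ltW t0) t1 (hansen i).
have := weighted_mono hw step.
have -> : \sum_i (w i)%:C *: (1%:M + p%:C *: (powmx (Z i) t - 1%:M)) = 1%:M.
  under eq_bigr => i _ do rewrite scalerDr scalerA mulrC -scalerA scalerBr.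
  rewrite big_split /= -scaler_sumr sumrB sumZ (weighted_const _ hw).
  by rewrite subrr scaler0 addr0.
move=> /(loewner_conj_herm (powmx_adj X 2^-1)).
rewrite mulmx1 (powmx_half_sqr pX) mulmx_sumr mulmx_suml => le_X.
apply: loewner_trans le_X _; rewrite /pmean_map.
under eq_bigr => i _ do rewrite -scalemxAr -scalemxAl -wgmeanE.
exact: loewner_refl.
Qed.

(** Exponents beyond 2 are reached by squaring: the mean of the squares is
    still at least 1, and [A^p = (A^2)^(p/2)]. *)
Lemma power_mean_pos_pow m n t (w : 'I_n -> R) : prob_vec w -> 0 < t -> t <= 1 ->
  forall p (A : 'I_n -> 'M[C]_m), (forall i, posdefmx (A i)) -> 1 <= p ->
  1%:M <=L power_mean_pos t w A ->
  power_mean_pos t w A <=L power_mean_pos t w (fun i => powmx (A i) p).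
Proof.
move=> hw t0 t1 p A pA p1 le1.
have small r (B : 'I_n -> 'M[C]_m) : (forall i, posdefmx (B i)) -> 1 <= r -> r <= 2 ->
    1%:M <=L power_mean_pos t w B ->
    power_mean_pos t w B <=L power_mean_pos t w (fun i => powmx (B i) r).
  move=> pB r1 r2 leB.
  have [pP fP] := power_mean_posP hw pB t0 t1.
  have pBr i := powmx_posdef r (pB i).
  have [pQ fQ] := power_mean_posP hw pBr t0 t1.
  have sub := pmean_map_pow_ge hw pB t0 t1 r1 r2 pP fP leB.
  exact: (pmean_map_subfixpoint_le hw pBr t0 t1 pP pQ sub fQ).
suff all_k k : forall p (A : 'I_n -> 'M[C]_m), (forall i, posdefmx (A i)) -> 1 <= p ->
    p < 2 ^+ k.+1 -> 1%:M <=L power_mean_pos t w A ->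
    power_mean_pos t w A <=L power_mean_pos t w (fun i => powmx (A i) p).
  apply: (all_k (Num.bound p) p A pA p1 _ le1).
  by apply: upper_nthrootP; exact: leqnSn.
elim: k => {p A pA p1 le1} [|k IH] p A pA p1 pk le1.
  by apply: small => //; rewrite expr1 in pk; exact: ltW.
have [p2|p2] := leP p 2; first exact: small pA p1 p2 le1.
have le12 : (1 : R) <= 2 by lra.
have sq := small 2 A pA le12 (lexx _) le1.
apply: (loewner_trans sq).
have pA2 i := powmx_posdef 2 (pA i).
have p21 : 1 <= p / 2 by lra.
have p2k : p / 2 < 2 ^+ k.+1 by rewrite ltr_pdivrMr // -exprSr.
have := IH (p / 2) _ pA2 p21 p2k (loewner_trans le1 sq).
have -> // : (fun i => powmx (powmx (A i) 2) (p / 2)) = (fun i => powmx (A i) p).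
by apply/funext => i; rewrite (powmxrM _ _ (pA i)); congr powmx; field.
Qed.

(** For [A = 1] this is the antitonicity of the inverse on the spectrum of [B];
    conjugation by [A^(-1/2)] reduces the general case to that one. *)
Lemma loewner_powmxN1 m (A B : 'M[C]_m) : posdefmx A -> posdefmx B -> A <=L B ->
  powmx B (-1) <=L powmx A (-1).
Proof.
move=> pA pB AB; have pM := posdef_sandwich (- 2^-1) pB pA.
have inv_le1 : powmx (powmx A (- 2^-1) *m B *m powmx A (- 2^-1)) (-1) <=L 1%:M.
  have := loewner_conj_herm (powmx_adj A (- 2^-1)) AB.
  rewrite (powmx_neghalf_sandwich pA); have [U [d [uU d0 ->]]] := posdef_spectral pM.
  rewrite (powmx_udiag _ _ uU) -(udiag1 uU) => /(udiag_le_inv uU) d1.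
  apply: udiag_le => j.
  by rewrite (powR_inv1 (ltW (d0 j))) invf_le1.
have MV : (powmx A (- 2^-1) *m B *m powmx A (- 2^-1)) *m
    (powmx A 2^-1 *m powmx B (-1) *m powmx A 2^-1) = 1%:M.
  rewrite -[X in _ *m X *m _ *m _](powmx1 pB) -!mulmxA (powmx_mulA _ _ _ pA) addNr.
  rewrite (powmx0 pA) mul1mx.
  by rewrite (powmx_mulA _ _ _ pB) subrr (powmx0 pB) mul1mx (powmx_mulNr _ pA).
rewrite -(powmx_inverse pM MV) in inv_le1.
have := loewner_conj_herm (powmx_adj A (- 2^-1)) inv_le1.
rewrite !mulmxA (powmx_mulNr _ pA) mul1mx -mulmxA (powmx_mulN _ pA) !mulmx1.
rewrite -(powmxD _ _ pA).
by have -> : - 2^-1 + - 2^-1 = -1 :> R by lra.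
Qed.

End PowerMean.

Theorem theorem3p5 (R : realType) (m n : nat) (hm : (0 < m)%N) (hn : (0 < n)%N)
    (A : 'I_n -> 'M[R[i]]_m) (hA : forall i, posdefmx (A i))
    (w : 'I_n -> R) (hw : prob_vec w) (p : R) (hp : 1 <= p) :
  (forall t : R, 0 < t -> t <= 1 ->
     1%:M <=L power_mean t w A ->
     power_mean t w A <=L power_mean t w (fun i => mxpow (A i) p)) /\
  (forall t : R, -1 <= t -> t < 0 ->
     power_mean t w A <=L 1%:M ->
     power_mean t w (fun i => mxpow (A i) p) <=L power_mean t w A).
Proof.
have mxpowE : (fun i => mxpow (A i) p) = (fun i => powmx (A i) p).
  by apply/funext => i; rewrite powmx.unlock.
rewrite mxpowE; split=> t.
  move=> t0 t1; rewrite /power_mean t0.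
  exact: power_mean_pos_pow hw t0 t1 p A hA hp.
move=> tge t0; rewrite /power_mean ltNge (ltW t0) /=.
have s0 : 0 < - t by lra.
have s1 : - t <= 1 by lra.
have invE : (fun i => invmx (A i)) = (fun i => powmx (A i) (-1)).
  by apply/funext => i; exact: invmx_powmx.
have pI i : posdefmx (powmx (A i) (-1)) by exact: powmx_posdef.
have invpE : (fun i => invmx (powmx (A i) p)) = (fun i => powmx (powmx (A i) (-1)) p).
  apply/funext => i; rewrite (invmx_powmx (powmx_posdef p (hA i))).
  by rewrite !(powmxrM _ _ (hA i)) mulrC.
rewrite invE invpE.
have pIp i := powmx_posdef p (pI i).
have [pX _] := power_mean_posP hw pI s0 s1.
have [pY _] := power_mean_posP hw pIp s0 s1.
have := power_mean_pos_pow hw s0 s1 pI hp.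
move: (power_mean_pos _ _ _) (power_mean_pos _ _ _) pX pY => X Y pX pY pow_le.
rewrite (invmx_powmx pX) (invmx_powmx pY) => X1.
apply: (loewner_powmxN1 pX pY); apply: pow_le.
have := loewner_powmxN1 (powmx_posdef (-1) pX) (posdef1 R m) X1.
by rewrite powmx1l (powmxrM _ _ pX) mulrNN mulr1 (powmx1 pX).
Qed.
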